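(* There exists an absolute constant $C>0$ such that for every integer $n\ge 1$ and every $o$-symmetric convex body $K\subset\mathbb{R}^n$ the following two statements hold. (i) There exists a GAP $\mathrm{P}(A,b)\subseteq K$ such that $$K\cap\mathbb{Z}^n\subseteq \mathrm{P}\left(A,\; n^{C\ln n}\, b\right).$$ (ii) There exists a GAP $\mathrm{P}(A,b)\subseteq K$ (possibly different from the one in (i)) such that $$|K\cap\mathbb{Z}^n| < (Cn)^{n}\,|\mathrm{P}(A,b)|.$$
   Context: An $o$-symmetric convex body in $\mathbb{R}^n$ is a compact convex set $K\subset\mathbb{R}^n$ with non-empty interior and $K=-K$. A (symmetric) generalized arithmetic progression, GAP for short, is a set of the form $$\mathrm{P}(A,b)=\{A z : z\in\mathbb{Z}^n,\ |z_i|\le b_i,\ 1\le i\le n\},$$ where $A\in\mathbb{Z}^{n\times n}$ with $\det A\neq 0$, and $b\in\mathbb{R}^n$ (the entries of $b$ need not be integers). For a real $t$, $\mathrm{P}(A,tb)$ is the set with $b$ replaced by the vector $tb$. $|\cdot|$ applied to a finite set denotes its cardinality. *)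

(* Defs.v *)
From HB Require Import structures.
From mathcomp Require Import all_boot all_order all_algebra.
From mathcomp Require Import finmap.
From mathcomp Require Import all_classical all_reals all_analysis.

Set Implicit Arguments.
Unset Strict Implicit.
Unset Printing Implicit Defensive.

Import Order.TTheory GRing.Theory Num.Theory.
Import numFieldNormedType.Exports.

Local Open Scope classical_set_scope.
Local Open Scope ring_scope.

Definition symmetric_convex_body (R : realType) (n : nat)
    (K : set 'cV[R]_n) : Prop :=
  [/\ compact K, convex_set K, K° !=set0 & [set - x | x in K] = K].

Definition int_lattice (R : realType) (n : nat) : set 'cV[R]_n :=
  range (map_mx (intr : int -> R)).

Arguments int_lattice : clear implicits.

(* The requirement [\det A != 0] is stated separately wherever a progression
   is introduced. *)
Definition GAP (R : realType) (n : nat) (A : 'M[int]_n) (b : 'cV[R]_n) :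
    set 'cV[R]_n :=
  [set map_mx (intr : int -> R) (A *m z) |
     z in [set z : 'cV[int]_n | forall i, `|z i 0|%:~R <= b i 0]].

Lemma finite_int_cube (n M : nat) :
  finite_set [set z : 'cV[int]_n | forall i, `|z i 0| <= M%:Z].
Proof.
pose f (w : 'cV['I_(M + M).+1]_n) : 'cV[int]_n :=
  map_mx (fun k : 'I_(M + M).+1 => (k : nat)%:Z - M%:Z) w.
apply: (@sub_finite_set _ _ (range f)); last first.
  by apply: finite_image; exact: finite_finset.
move=> z /= zM.
exists (\col_i inord (absz (z i 0 + M%:Z))) => //.
apply/matrixP => i j; rewrite (ord1 j) !mxE.
have /andP[z1 z2] : - M%:Z <= z i 0 <= M%:Z by rewrite -ler_norml; exact: zM.
have z3 : 0 <= z i 0 + M%:Z by rewrite -lerBlDr sub0r.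
rewrite inordK ?gez0_abs ?addrK //.
by rewrite ltnS -lez_nat gez0_abs // PoszD lerD2r.
Qed.

Lemma finite_int_bounded (R : realType) (n : nat) (r : R) :
  finite_set [set z : 'cV[int]_n | forall i, `|z i 0|%:~R <= r].
Proof.
apply: sub_finite_set (@finite_int_cube n (Num.truncn `|r|).+1) => z /= zr i.
rewrite -(ler_int R); apply: (le_trans (zr i)).
by apply: (le_trans (ler_norm r)); apply/ltW; exact: truncnS_gt.
Qed.

(* The next two lemmas ensure that [fset_set], whose value is [fset0] on
   infinite sets, computes the actual cardinality in the cases of interest. *)
Lemma finite_GAP (R : realType) (n : nat) (A : 'M[int]_n) (b : 'cV[R]_n) :
  finite_set (GAP A b).
Proof.
apply: finite_image.
apply: sub_finite_set (@finite_int_bounded R n `|b|) => z /= zb i.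
apply: (le_trans (zb i)); apply: (le_trans (ler_norm _)).
rewrite /Num.norm /= mx_normrE.
exact: (le_bigmax _ (fun ij : 'I_n * 'I_1 => `|b ij.1 ij.2|) (i, 0)).
Qed.

Lemma finite_lattice_points (R : realType) (n : nat) (K : set 'cV[R]_n) :
  compact K -> finite_set (K `&` int_lattice R n).
Proof.
move=> /compact_bounded /pinfty_ex_gt0 [r r0 Kr].
apply: (@sub_finite_set _ _
  (map_mx (intr : int -> R) @` [set z : 'cV[int]_n | forall i, `|z i 0|%:~R <= r])).
  move=> x [Kx [z _ zx]]; exists z => //= i.
  apply: le_trans (Kr _ Kx); rewrite -zx.
  rewrite [leRHS]/Num.norm /= mx_normrE.
  apply: le_trans (le_bigmax _ (fun ij : 'I_n * 'I_1 => `|_ ij.1 ij.2|) (i, 0)).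
  by rewrite /= mxE intr_norm.
by apply: finite_image; exact: finite_int_bounded.
Qed.

(* Main.v *)
Require Import Defs.
From HB Require Import structures.
From mathcomp Require Import all_boot all_order all_algebra perm.
From mathcomp Require Import finmap.
From mathcomp Require Import all_classical all_reals all_analysis.
From mathcomp Require Import zify ring lra.

Set Implicit Arguments.
Unset Strict Implicit.
Unset Printing Implicit Defensive.

Import Order.TTheory GRing.Theory Num.Theory.
Import numFieldNormedType.Exports.

Local Open Scope fset_scope.
Local Open Scope classical_set_scope.
Local Open Scope ring_scope.

(** The proof has two halves, both resting on elementary geometry of numbers.

    Containment.  Choosing [n] vectors of [K] whose determinant is at least half
    of the supremum gives an invertible [X] such that [K] contains the image of
    the cross-polytope and lies in the image of the cube of half-side 2
    ([near_auerbach]); up to factors polynomial in [n], [K] is therefore the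
    unit ball of the Euclidean norm [|G x|] with [G = X^-1].  One looks for a
    basis of the integer lattice that is nearly orthogonal for this norm.  A
    Korkine-Zolotarev basis ([korkine_zolotarev]) writes the squared norm as
    [\sum_l d_l (N x)_l^2] with [N] upper unitriangular, where each [d_i] is the
    squared minimum of a projected lattice.  Minkowski's theorem, which for a
    triangular lattice is a pigeonhole argument ([short_vector_triangular]),
    bounds [d_i] by [9 n] times the geometric mean of [d_i, ..., d_k], and
    averaging gives [d_i <= n^(O(ln n)) d_k] for [i <= k] ([kz_decay]).  Seysen's
    divide and conquer ([seysen]) then multiplies [N] by an integer matrix so
    that the product and its inverse both have entries [n^(O(ln n))].  In the
    resulting basis the coordinate box that fits inside [K] and the coordinate
    box needed to cover [K] differ by a factor [n^(O(ln n))]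
    ([containing_progression]).  In dimension 1 the factor is exactly 1, and the
    largest integer point of [K] is used instead.

    Cardinality.  Rounded to powers of 2, the successive minima of [K] are
    attained by independent integer vectors [a_k] with exponents [e_k], where
    [2^(e_k - 1) a_k] lies in [K] if [e_k > 0] ([adapted_columns]).  In a
    lattice basis adapted to the flag they span, two lattice points of [K] whose
    [k]-th coordinates agree modulo [2^(e_k + 1)] for all [k] are equal
    ([congruent_points_eq]), so [K] has at most [\prod_k 2^(e_k + 1)] lattice
    points.  The progression on the [a_k] with bounds [2^(e_k - 1) / n], rounded
    down (0 if [e_k = 0]), lies in [K] by convexity and has, factor by factor,
    at least the fraction [1 / (4 n)] of that many points
    ([progression_of_comparable_cardinality]). *)

(** * Counting in boxes *)

Lemma leq_card_fset (T U : choiceType) (f : T -> U) (A : {fset T})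
    (B : {fset U}) :
  (forall x, x \in A -> f x \in B) -> {in A &, injective f} ->
  (#|` A| <= #|` B|)%N.
Proof.
move=> fAB finj; have <- : #|` (f @` A)%fset| = #|` A| by apply: card_in_imfset.
by apply: fsubset_leq_card; apply/fsubsetP => _ /imfsetP[x /= xA ->]; exact: fAB.
Qed.

(** Boxes are made of vectors over [nat], and not of functions, to have a
    [choiceType] on which [#|` _|] makes sense. *)
Lemma nat_box_fset (n : nat) (q : 'I_n -> nat) :
  {B : {fset 'cV[nat]_n} |
    (forall z, (z \in B) = [forall i, (z i ord0 < q i)%N]) &
    #|` B| = (\prod_i q i)%N}.
Proof.
pose M := (\max_i q i).+1.
have qM i : (q i <= M)%N by apply/leqW/(leq_bigmax i).
pose F := family (fun i => [pred k : 'I_M | (k < q i)%N]).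
pose h (c : {ffun 'I_n -> 'I_M}) : 'cV[nat]_n := \col_i nat_of_ord (c i).
have h_inj : injective h.
  move=> c d /matrixP cd; apply/ffunP => i; apply/val_inj => /=.
  by have := cd i 0; rewrite !mxE.
exists [fset h c | c in F]%fset.
  move=> z; apply/imfsetP/forallP => [[c /= /familyP cF ->] i|zq].
    by have := cF i; rewrite !mxE.
  exists [ffun i => inord (z i ord0)].
    apply/familyP => i; rewrite ffunE inE inordK //.
    exact: leq_trans (zq i) (qM i).
  apply/matrixP => i j; rewrite ord1 !mxE ffunE inordK //.
  exact: leq_trans (zq i) (qM i).
rewrite card_imfset //= -cardE.
rewrite card_family foldrE big_image /=; apply: eq_bigr => i _.
transitivity #|[set widen_ord (qM i) k | k in 'I_(q i)]%SET|.
  apply: eq_card => k; apply/idP/imsetP => [kq|[l _ ->]]; last exact: (ltn_ord l).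
  by exists (Ordinal kq) => //; apply: val_inj.
rewrite card_imset ?card_ord // => k l /(congr1 val) /= kl; exact: val_inj.
Qed.

(** * Integer matrices and lattice bases *)

Definition replace_col (R : Type) n (k : 'I_n) (A : 'M[R]_n) (v : 'cV[R]_n) :=
  \matrix_(i, j) (if j == k then v i 0 else A i j).

Lemma det_replace_col (R : comNzRingType) n (k : 'I_n) (A : 'M[R]_n)
    (v : 'cV[R]_n) :
  \det (replace_col k A v) = (\adj A *m v) k 0.
Proof.
rewrite (expand_det_col _ k) mxE; apply: eq_bigr => i _.
rewrite !mxE eqxx mulrC; congr (_ * _); rewrite /cofactor; congr (_ * \det _).
by apply/matrixP => a b; rewrite !mxE eq_sym (negPf (neq_lift _ _)).
Qed.

(** Cramer's rule: replacing the [k]-th column of [A] by a vector multiplies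
    the determinant by the [k]-th coordinate of that vector in the columns of
    [A]. Both the exchange argument and the choice of a nearly maximal
    determinant use it. *)
Lemma cramer_coord (R : fieldType) n (k : 'I_n) (A : 'M[R]_n) (c : 'cV[R]_n) :
  \det (replace_col k A (A *m c)) = \det A * c k 0.
Proof. by rewrite det_replace_col mulmxA mul_adj_mx mul_scalar_mx mxE. Qed.

(** Extends the primitive part of an integer vector to a lattice basis; this is
    the Smith normal form of a one-column matrix. *)
Lemma column_clearing (n : nat) (v : 'cV[int]_n.+1) :
  {L : 'M[int]_n.+1 & L \in unitmx &
    {d : int | v = L *m (d *: delta_mx 0 0)}}.
Proof.
have [L Lu [R Ru [d _ ->]]] := int_Smith_normal_form v.
exists L => //; exists (d`_0 * R 0 0); rewrite -mulmxA; congr (_ *m _).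
apply/matrixP => i j; rewrite !ord1 !mxE big_ord1 !mxE eqxx andbT.
by case: (unliftP 0 i) => [k|] -> /=;
  rewrite ?mulr0n ?mulr1n ?mulr1 ?mul0r ?mulr0.
Qed.

(** The columns of [U] form a lattice basis adapted to the flag spanned by the
    columns of [A]. *)
Lemma hermite_triangular (n : nat) (A : 'M[int]_n) :
  {U : 'M[int]_n & U \in unitmx &
    {T : 'M[int]_n | A = U *m T & forall i j : 'I_n, (j < i)%N -> T i j = 0}}.
Proof.
elim: n A => [|n IHn] A.
  exists 1%:M; first exact: unitmx1.
  by exists A; [rewrite mul1mx|case].
have [L Lu [d Ld]] := column_clearing (col 0 A).
have [B defB] : {B : 'M[int]_(1 + n) | B = invmx L *m A} by exists (invmx L *m A).
have [U Uu [T BT Ttri]] := IHn (drsubmx B).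
pose V : 'M[int]_(1 + n) := block_mx 1%:M 0 0 U.
have Vu : V \in unitmx by rewrite unitmxE det_ublock det1 mul1r -unitmxE.
exists (L *m V); first by rewrite unitmx_mul Lu.
have Bcol : col 0 B = d *: delta_mx 0 0.
  by rewrite colE defB -mulmxA -colE Ld mulKmx.
have Bdl : dlsubmx B = 0.
  apply/matrixP => i j; rewrite !mxE ord1.
  have /matrixP/(_ (rshift 1 i) 0) := Bcol.
  rewrite !mxE /= mulr0 => <-; congr (B _ _); exact: val_inj.
pose W : 'M[int]_(1 + n) := block_mx (ulsubmx B) (ursubmx B) 0 T.
have BW : B = V *m W.
  rewrite /V /W mulmx_block !mul1mx !mul0mx !mulmx0 !addr0 add0r -BT.
  by rewrite -{1}Bdl submxK.
exists W; first by rewrite -mulmxA -BW defB mulKVmx.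
move=> i j; case: (@split_ordP 1 n i) => i' ->; rewrite ?(ord1 i') //.
case: (@split_ordP 1 n j) => j' -> ij.
  by apply: etrans (block_mxEdl _ _ _ _ _ _) _; rewrite mxE.
by apply: etrans (block_mxEdr _ _ _ _ _ _) _; apply: Ttri.
Qed.

(** * Symmetric convex bodies *)

Section ConvexBody.
Variables (R : realType) (n : nat) (K : set 'cV[R]_n).
Hypothesis Kbody : symmetric_convex_body K.

Lemma body_opp x : K x -> K (- x).
Proof. by move=> Kx; have [_ _ _ <-] := Kbody; exists x. Qed.

Lemma body_conv x y t : K x -> K y -> 0 <= t <= 1 -> K (t *: x + (1 - t) *: y).
Proof.
move=> Kx Ky t01; have [_ Kc _ _] := Kbody.
have t01' : Itv.spec (@Itv.num_sem R) (Itv.Real `[0%Z, 1%Z]) t.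
  rewrite /Itv.num_sem /= in_itv /= t01 andbT; exact: num_real.
pose l := Itv.mk t01'.
by have := Kc x y l; rewrite !inE => /(_ Kx Ky).
Qed.

Lemma body0 : K 0.
Proof.
have [_ _ [x /interior_subset Kx] _] := Kbody.
have := @body_conv x (- x) 2^-1 Kx (body_opp Kx).
have -> : (1 - 2^-1 : R) = 2^-1 by lra.
by rewrite scalerN subrr; apply; lra.
Qed.


Lemma body_shrink x t : K x -> 0 <= t <= 1 -> K (t *: x).
Proof.
by move=> Kx t01; have := body_conv Kx body0 t01; rewrite scaler0 addr0.
Qed.

Lemma body_sum m (x : 'I_m -> 'cV[R]_n) (c : 'I_m -> R) :
  (forall j, K (x j)) -> \sum_j `|c j| <= 1 -> K (\sum_j c j *: x j).
Proof.
move=> Kx c1.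
suff [y Ky ->] : exists2 y, K y & \sum_j c j *: x j = (\sum_j `|c j|) *: y.
  by apply: body_shrink; rewrite // c1 sumr_ge0.
pose rel (u : 'cV[R]_n) (t : R) := 0 <= t /\ exists2 y, K y & u = t *: y.
suff [] : rel (\sum_j c j *: x j) (\sum_j `|c j|) by [].
apply: big_ind2 => [|u t v s [t0 [y Ky ->]] [s0 [z Kz ->]]|j _].
- by split=> //; exists 0; rewrite ?scaler0 //; exact: body0.
- split; first exact: addr_ge0.
  have [ts0|ts0] := eqVneq (t + s) 0.
    exists 0; first exact: body0.
    have [-> ->] : t = 0 /\ s = 0 by split; lra.
    by rewrite !scale0r addr0 scaler0.
  exists ((t / (t + s)) *: y + (1 - t / (t + s)) *: z).
    apply: body_conv => //; rewrite divr_ge0 ?addr_ge0 //=.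
    by rewrite ler_pdivrMr ?mul1r ?lerDl // lt_def ts0 addr_ge0.
  rewrite scalerDr !scalerA mulrBr mulr1 mulrC divfK //.
  by rewrite [t + s]addrC addrK.
- split=> //; have [c0|c0] := leP 0 (c j).
    by exists (x j); rewrite ?ger0_norm.
  by exists (- x j); [exact: body_opp|rewrite ltr0_norm // scalerN scaleNr opprK].
Qed.

Lemma body_bounded : exists2 r : R, 0 < r &
  forall x, K x -> forall i, `|x i 0| <= r.
Proof.
have [/compact_bounded /pinfty_ex_gt0 [r r0 Kr] _ _ _] := Kbody.
exists r => // x Kx i; apply: le_trans (Kr _ Kx).
rewrite [leRHS]/Num.norm /= mx_normrE.
exact: (le_bigmax _ (fun ij : 'I_n * 'I_1 => `|x ij.1 ij.2|) (i, 0)).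
Qed.

(** If [x + v] and [x] are in [K] then so is [v / 2], the midpoint of [x + v]
    and [- x]; hence an interior point makes the origin interior. *)
Lemma body_scaled_basis : exists2 eps : R, 0 < eps &
  forall i, K (eps *: delta_mx i 0).
Proof.
have [_ _ [x /nbhs_ballP[e /= e0 xeK]] _] := Kbody.
have Kx : K x by apply: xeK; exact: ballxx.
exists (e / 4); first by rewrite divr_gt0.
move=> i.
have Ky : K (x + (e / 2) *: delta_mx i 0).
  apply: xeK; rewrite -ball_normE /ball_ /= opprD addNKr normrN normrZ.
  rewrite gtr0_norm ?divr_gt0 //.
  apply: (@le_lt_trans _ _ (e / 2 * 1)); last by lra.
  apply: ler_wpM2l; first by rewrite divr_ge0 // ltW.
  rewrite [leLHS]/Num.norm /= mx_normrE; apply/bigmax_leP; split=> // -[a b] _ /=.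
  by rewrite mxE normr_nat; case: (_ && _).
have := @body_conv _ _ 2^-1 Ky (body_opp Kx).
have -> : (1 - 2^-1 : R) = 2^-1 by lra.
rewrite -scalerDr addrAC subrr add0r scalerA.
have -> : 2^-1 * (e / 2) = e / 4 by lra.
by apply; lra.
Qed.

End ConvexBody.

(** * Discrete successive minima and the number of lattice points *)

Section Adapted.
Variables (R : realType) (n : nat) (K : set 'cV[R]_n).
Hypothesis Kbody : symmetric_convex_body K.

Definition real_vec (z : 'cV[int]_n) : 'cV[R]_n := map_mx intr z.

(** The exponent [e i] plays the role of the integer part of
    [1 - log2 lambda_i], where [lambda_i] is the [i]-th successive minimum. *)
Definition weighted_columns (A : 'M[int]_n) (e : 'I_n -> nat) :=
  \det A != 0 /\
  forall i, (0 < e i)%N -> K (2 ^+ (e i).-1 *: real_vec (col i A)).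

Lemma weight_bounded :
  exists J : nat, forall A e, weighted_columns A e -> forall i, (e i <= J)%N.
Proof.
have [r r0 Kr] := body_bounded Kbody.
exists (Num.truncn r).+2 => A e [A0 wA] i.
have [->//|e0] := posnP (e i).
have [j Aji] : exists j, A j i != 0.
  apply/existsP; apply: contraNT A0; rewrite negb_exists => /forallP A0.
  rewrite (expand_det_col _ i) big1 // => j _.
  by move/(_ j): A0; rewrite negbK => /eqP ->; rewrite mul0r.
rewrite -(prednK e0) ltnS; apply: ltnW; apply: (leq_trans (ltn_expl _ (ltnSn 1))).
rewrite -(ler_nat R); apply: le_trans (ltW (truncnS_gt r)).
apply: le_trans (Kr _ (wA i e0) j).
rewrite !mxE normrM normrX normr_nat natrX ler_peMr ?exprn_ge0 //.
by rewrite -intr_norm ler1z; move: Aji; rewrite -normr_gt0.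
Qed.

(** If [v] is short enough to deserve a weight larger than [e k] and is
    independent of the other columns, then [v] improves on column [k]. *)
Lemma exchange_column A e (v : 'cV[int]_n) k :
  weighted_columns A e -> \det (replace_col k A v) != 0 ->
  K (2 ^+ e k *: real_vec v) ->
  weighted_columns (replace_col k A v)
    (fun i => if i == k then (e k).+1 else e i).
Proof.
move=> [A0 wA] dv Kv; split=> // i; case: eqVneq => [->|ik] /=.
  move=> _; congr (K (_ *: real_vec _)): Kv.
  by apply/colP => j; rewrite !mxE eqxx.
move=> /wA; congr (K (_ *: real_vec _)).
by apply/colP => j; rewrite !mxE (negPf ik).
Qed.

Lemma permute_columns A e (s : 'S_n) :
  weighted_columns A e -> weighted_columns (col_perm s A) (e \o s).
Proof.
move=> [A0 wA]; split=> [|i /= /wA].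
  by rewrite col_permE det_mulmx det_perm mulf_neq0 // signr_eq0.
by congr (K (_ *: real_vec _)); apply/colP => j; rewrite !mxE.
Qed.

Lemma sorting_perm (e : 'I_n -> nat) :
  exists s : 'S_n, forall i j : 'I_n, (i <= j)%N -> (e (s j) <= e (s i))%N.
Proof.
pose t := [tuple e i | i < n].
have /tuple_permP[s ts] : perm_eq (sort geq t) t by rewrite perm_sort.
exists s => i j ij.
have szs : size (sort geq t) = n by rewrite size_sort size_tuple.
have srt : sorted geq (sort geq t).
  by apply: sort_sorted => x y; exact: leq_total.
have nths k : nth 0%N (sort geq t) k = nth 0%N [tuple tnth t (s i) | i < n] k.
  by rewrite -ts.
have nthE (k : 'I_n) : nth 0%N (sort geq t) k = e (s k).
  by rewrite nths -tnth_nth !tnth_mktuple.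
rewrite -!nthE; have geq_tr : transitive geq.
  by move=> x y z /= xy zx; exact: leq_trans zx xy.
by apply: (sorted_leq_nth geq_tr leqnn 0%N srt) => //; rewrite inE szs.
Qed.

(** Columns of maximal total weight behave like vectors attaining the successive
    minima: every integer vector [v] with [2^(e k) v] in [K] lies in the span of
    the columns other than the [k]-th, since otherwise exchanging it for column
    [k] would raise the total weight. *)
Lemma adapted_columns :
  exists A e, [/\ weighted_columns A e,
    forall i j : 'I_n, (i <= j)%N -> (e j <= e i)%N &
    forall (v : 'cV[int]_n) k, K (2 ^+ e k *: real_vec v) ->
      \det (replace_col k A v) = 0].
Proof.
have [J bJ] := weight_bounded.
pose P s := `[< exists A e, weighted_columns A e /\ s = (\sum_i e i)%N >].
have exP : exists s, P s.
  exists 0%N; apply/asboolP; exists 1%:M, (fun=> 0%N); split=> //.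
    by split=> //; rewrite det1 oner_eq0.
  by rewrite big1.
have bP s : P s -> (s <= \sum_(i < n) J)%N.
  by move=> /asboolP[A [e [wA ->]]]; apply: leq_sum => i _; exact: bJ wA i.
case: (ex_maxnP exP bP) => s /asboolP[A0 [e0 [wA0 s0]]] smax.
have [p psort] := sorting_perm e0.
exists (col_perm p A0), (e0 \o p); split => //; first exact: permute_columns.
move=> v k Kv; apply/eqP; apply: contraT => dv.
have wA' := exchange_column (permute_columns p wA0) dv Kv.
have : (\sum_i (if i == k then ((e0 \o p) k).+1 else (e0 \o p) i) <= s)%N.
  by apply: smax; apply/asboolP; do 2!eexists; split; [exact: wA'|].
have -> : s = (\sum_i e0 (p i))%N by rewrite s0 (reindex_inj (@perm_inj _ p)).
rewrite (bigD1 k) //= eqxx [X in (_ <= X)%N](bigD1 k) //=.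
rewrite addSn ltn_add2l /= (eq_bigr (fun i => e0 (p i))) ?ltnn // => i.
by move=> /negPf ->.
Qed.

(** Here [U *m w] is the difference of two lattice points of [K], hence half of
    it lies in [K]. If [w k 0] is the last nonzero coordinate then, the moduli
    decreasing with the index, [2^(e k + 1)] divides all of [w]; the quotient is
    so short that it lies in the span of the columns of [A] of index smaller
    than [k], contradicting [w k 0 != 0]. *)
Lemma congruent_points_eq A e (U T : 'M[int]_n) (w : 'cV[int]_n) :
  U \in unitmx -> A = U *m T ->
  (forall i j : 'I_n, (j < i)%N -> T i j = 0) -> \det A != 0 ->
  (forall i j : 'I_n, (i <= j)%N -> (e j <= e i)%N) ->
  (forall (v : 'cV[int]_n) k, K (2 ^+ e k *: real_vec v) ->
      \det (replace_col k A v) = 0) ->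
  K (2^-1 *: real_vec (U *m w)) ->
  (forall i, ((2 ^+ (e i).+1)%R %| w i ord0)%Z) -> w = 0.
Proof.
move=> Uu AUT Ttri A0 esort Aexch Kw wdvd.
have w0 (k : 'I_n) : (forall i : 'I_n, (k < i)%N -> w i 0 = 0) -> w k 0 = 0.
  move=> wk0; pose q : int := 2 ^+ (e k).+1.
  have q0 : q != 0 by rewrite expf_neq0.
  have [u wu] : exists u : 'cV[int]_n, w = q *: u.
    exists (\col_i (w i ord0 %/ q)%Z).
    apply/colP => i; rewrite !mxE mulrC divzK //.
    have [ik|ki] := leqP i k; last by rewrite wk0 // dvdz0.
    apply: dvdz_trans (wdvd i); rewrite -[(e i).+1](@subnK (e k).+1).
      by rewrite exprD dvdz_mull.
    by rewrite ltnS esort.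
  have adj0 (i : 'I_n) : (k <= i)%N -> (\adj A *m (U *m u)) i 0 = 0.
    move=> ki; rewrite -det_replace_col; apply: Aexch.
    have -> : 2 ^+ e i *: real_vec (U *m u) =
        (2 ^+ (e k - e i))^-1 *: (2^-1 *: real_vec (U *m w)).
      apply/colP => j; rewrite wu -scalemxAr !mxE rmorphM /= /q rmorphXn /=.
      rewrite -[2%:~R]/(2 : R) exprS.
      have -> : (2 : R) ^+ e k = 2 ^+ (e k - e i) * 2 ^+ e i.
        by rewrite -exprD subnK // esort.
      by field; rewrite expf_neq0 // pnatr_eq0.
    apply: (body_shrink Kbody) => //; rewrite invr_ge0 exprn_ge0 //=.
    by rewrite invf_le1 ?exprn_gt0 // exprn_ege1 // ler1n.
  have Tadj : T *m (\adj A *m (U *m u)) = \det A *: u.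
    apply: (can_inj (mulKmx Uu)).
    by rewrite -scalemxAr mulmxA -AUT mulmxA mul_mx_adj mul_scalar_mx.
  have /eqP : \det A * u k 0 = 0.
    have /colP/(_ k) := Tadj; rewrite !mxE => <-.
    rewrite big1 // => i _; have [ki|ik] := leqP k i.
      by have := adj0 _ ki; rewrite mxE => ->; rewrite mulr0.
    by rewrite Ttri // mul0r.
  by rewrite mulf_eq0 (negPf A0) /= wu mxE => /eqP ->; rewrite mulr0.
apply/colP => k; rewrite mxE.
have [m] := ubnP (n - k); elim: m k => // m IHm k km.
by apply: w0 => i ki; apply: IHm; have := ltn_ord i; lia.
Qed.

End Adapted.

Lemma real_vecM (R : realType) n (A : 'M[int]_n) (z : 'cV[int]_n) :
  real_vec R (A *m z) = \sum_j (z j 0)%:~R *: real_vec R (col j A).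
Proof.
apply/colP => i; rewrite !mxE summxE rmorph_sum /=; apply: eq_bigr => j _.
by rewrite !mxE rmorphM /= mulrC.
Qed.

Lemma real_vec_inj (R : realType) n : injective (@real_vec R n).
Proof.
by move=> x y /colP xy; apply/colP => i; have := xy i; rewrite !mxE => /intr_inj.
Qed.

Lemma mulmx_det_inj n (A : 'M[int]_n) (x y : 'cV[int]_n) :
  \det A != 0 -> A *m x = A *m y -> x = y.
Proof.
move=> A0 /(congr1 (mulmx (\adj A))); rewrite !mulmxA mul_adj_mx !mul_scalar_mx.
by move=> /colP xy; apply/colP => i; have := xy i; rewrite !mxE; exact: mulfI.
Qed.

Lemma card_GAP_ge (R : realType) n (A : 'M[int]_n) (m : 'I_n -> nat) :
  \det A != 0 ->
  (\prod_i (2 * m i).+1 <= #|` fset_set (GAP A (\col_i (m i)%:R : 'cV[R]_n))|)%N.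
Proof.
move=> A0; have [B BE <-] := nat_box_fset (fun i => (2 * m i).+1).
pose z (c : 'cV[nat]_n) : 'cV[int]_n := \col_i ((c i ord0)%:Z - (m i)%:Z).
apply: (@leq_card_fset _ _ (fun c => real_vec R (A *m z c))) => [c|c d _ _].
  rewrite BE => /forallP cm; rewrite in_fset_set ?inE; last exact: finite_GAP.
  exists (z c) => // i; rewrite !mxE -[X in _ <= X]/((m i)%:Z%:~R) ler_int.
  by have /= := cm i; lia.
move=> /real_vec_inj /(mulmx_det_inj A0) /colP cd; apply/matrixP => i j.
by rewrite ord1; have := cd i; rewrite !mxE => /addIr [].
Qed.

(** The residues of the coordinates in an adapted lattice basis separate the
    lattice points of [K]. *)
Lemma card_lattice_points_le (R : realType) n (K : set 'cV[R]_n) A e :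
  symmetric_convex_body K ->
  \det A != 0 -> (forall i j : 'I_n, (i <= j)%N -> (e j <= e i)%N) ->
  (forall (v : 'cV[int]_n) k, K (2 ^+ e k *: real_vec R v) ->
      \det (replace_col k A v) = 0) ->
  (#|` fset_set (K `&` int_lattice R n)| <= \prod_i 2 ^ (e i).+1)%N.
Proof.
move=> Kb A0 esort Aexch; have [U Uu [T AUT Ttri]] := hermite_triangular A.
have [B BE <-] := nat_box_fset (fun i => 2 ^ (e i).+1)%N.
pose w (x : 'cV[R]_n) := invmx U *m map_mx Num.floor x.
pose q i : int := 2 ^+ (e i).+1.
have q0 i : q i != 0 by rewrite expf_neq0.
have qE i : q i = (2 ^ (e i).+1)%N%:Z by rewrite /q -[2]/(2%:R : int) -natrX natz.
have Kfin : finite_set (K `&` int_lattice R n).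
  by apply: finite_lattice_points; have [] := Kb.
apply: (@leq_card_fset _ _ (fun x => \col_i `|(w x i ord0 %% q i)%Z|%N)).
  move=> x _; rewrite BE; apply/forallP => i.
  rewrite mxE -ltz_nat gez0_abs ?modz_ge0 //.
  by rewrite -qE ltz_pmod // /q exprn_gt0.
move=> x y; rewrite !in_fset_set // !inE.
move=> -[Kx [z _ zx]] [Ky [t _ ty]] /colP wxy.
have fl (u : 'cV[int]_n) : map_mx Num.floor (map_mx intr u : 'cV[R]_n) = u.
  by apply/colP => i; rewrite !mxE intrKfloor.
suff : w x - w y = 0.
  move/subr0_eq/(can_inj (mulKVmx Uu)); rewrite -zx -ty !fl.
  by move=> ->.
apply: (congruent_points_eq Kb Uu AUT Ttri A0 esort Aexch).
  rewrite /w -mulmxBr mulKVmx // -zx -ty !fl.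
  have := body_conv Kb Kx (body_opp Kb Ky) (_ : 0 <= 2^-1 <= 1).
  have -> : (1 - 2^-1 : R) = 2^-1 by lra.
  rewrite -scalerDr -zx -ty => /(_ _); rewrite /real_vec map_mxB; apply; lra.
move=> i; rewrite !mxE -/(w x i 0) -/(w y i 0) -/(q i).
rewrite -eqz_mod_dvd; have := wxy i; rewrite !mxE => /(congr1 Posz).
by rewrite !gez0_abs ?modz_ge0 // => ->.
Qed.

Lemma progression_of_comparable_cardinality (R : realType) n (K : set 'cV[R]_n) :
  (0 < n)%N -> symmetric_convex_body K ->
  exists (A : 'M[int]_n) (b : 'cV[R]_n),
  [/\ \det A != 0, GAP A b `<=` K, (0 < #|` fset_set (GAP A b)|)%N &
    (#|` fset_set (K `&` int_lattice R n)| <=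
     (4 * n) ^ n * #|` fset_set (GAP A b)|)%N].
Proof.
move=> n0 Kb; have [A [e [[A0 wA] esort Aexch]]] := adapted_columns Kb.
pose m i := if e i == 0%N then 0%N else (2 ^ (e i).-1 %/ n)%N.
have cG := card_GAP_ge R m A0.
exists A, (\col_i (m i)%:R); split => //.
- move=> _ [z zm <-]; rewrite -/(real_vec R (A *m z)) real_vecM.
  pose y i := if e i == 0%N then 0 else 2 ^+ (e i).-1 *: real_vec R (col i A).
  pose c i : R := (z i 0)%:~R / 2 ^+ (e i).-1.
  rewrite (eq_bigr (fun i => c i *: y i)); last first.
    move=> i _; rewrite /c /y; case: eqVneq => [ei|ei].
      have := zm i; rewrite !mxE /m ei /= mulr0n lerz0 normr_le0 => /eqP ->.
      by rewrite !scaler0 scale0r.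
    by rewrite scalerA divfK // expf_neq0.
  apply: body_sum => //.
    move=> i; rewrite /y; case: eqVneq => [_|ei]; first exact: body0.
    by apply: wA; rewrite lt0n.
  apply: (@le_trans _ _ (\sum_(i < n) n%:R^-1)); last first.
    by rewrite sumr_const card_ord -[_ *+ _]mulr_natl divff // pnatr_eq0 -lt0n.
  apply: ler_sum => i _; have := zm i.
  rewrite !mxE /c normrM normfV normrX normr_nat.
  rewrite ler_pdivrMr ?exprn_gt0 // -intr_norm => /le_trans; apply.
  rewrite mulrC ler_pdivlMr ?ltr0n // /m; case: ifP => [_|_].
    by rewrite mul0r exprn_ge0.
  by rewrite -natrM -natrX ler_nat leq_trunc_div.
- by apply: leq_trans cG; rewrite prodn_gt0.
- apply: leq_trans (card_lattice_points_le Kb A0 esort Aexch) _.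
  apply: leq_trans (leq_mul (leqnn _) cG).
  rewrite -[X in (_ ^ X)%N]card_ord -prod_nat_const -big_split /=.
  apply: leq_prod => i _; rewrite /m; case: eqVneq => [->|ei] /=.
    by rewrite expn1 muln1; lia.
  have := ltn_ceil (2 ^ (e i).-1) n0.
  have -> : (2 ^ (e i).+1 = 4 * 2 ^ (e i).-1)%N.
    by rewrite -[in LHS](prednK (_ : 0 < e i)%N) ?lt0n // !expnS mulnA.
  by move: (2 ^ (e i).-1)%N (_ %/ n)%N => a d; nia.
Qed.

(** * Korkine-Zolotarev reduction *)

Section KorkineZolotarev.
Variable R : realType.

Definition sqn m (v : 'cV[R]_m) : R := \sum_k v k 0 ^+ 2.

Definition upper_unitri n (N : 'M[R]_n) :=
  forall i j : 'I_n, (j <= i)%N -> N i j = (i == j)%:R.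

(** The quadratic form [\sum_l d_l (N x)_l^2] is Korkine-Zolotarev reduced when
    [d_i] is at most every nonzero value of its truncation to the indices
    [l >= i], which is the form of the lattice projected along the first basis
    vectors. *)
Definition kz_reduced n (N : 'M[R]_n) (d : 'cV[R]_n) :=
  forall (i : 'I_n) (z : 'cV[int]_n),
    (exists2 l : 'I_n, (i <= l)%N & z l 0 != 0) ->
    d i 0 <=
      \sum_(l < n | (i <= l)%N) d l 0 * (N *m map_mx intr z) l 0 ^+ 2.

Lemma finite_set_argmin (T : choiceType) (S : set T) (f : T -> R) :
  finite_set S -> S !=set0 -> exists2 x, S x & forall y, S y -> f x <= f y.
Proof.
move=> Sfin [x Sx]; have xS : x \in fset_set S by rewrite in_fset_set ?inE.
have [/= y _ ymin] :=
  @arg_minP _ R (fset_set S) [` xS]%fset xpredT (fun z => f (val z)) isT.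
exists (val y) => [|z Sz]; first by have := valP y; rewrite in_fset_set ?inE.
have zS : z \in fset_set S by rewrite in_fset_set ?inE.
exact: ymin [` zS]%fset isT.
Qed.

(** A left inverse of [G] bounds the coordinates of an integer vector in terms
    of its image, so only finitely many images have bounded norm. *)
Lemma shortest_vector n m (G : 'M[R]_(m, n.+1)) (L : 'M[R]_(n.+1, m)) :
  L *m G = 1%:M ->
  exists2 z : 'cV[int]_n.+1, z != 0 &
    forall y : 'cV[int]_n.+1, y != 0 ->
      sqn (G *m map_mx intr z) <= sqn (G *m map_mx intr y).
Proof.
move=> LG; pose f (z : 'cV[int]_n.+1) := sqn (G *m map_mx intr z).
pose e0 : 'cV[int]_n.+1 := delta_mx 0 0.
have e0N0 : e0 != 0.
  apply/eqP => /colP/(_ 0); rewrite !mxE !eqxx /=; exact/eqP/oner_neq0.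
pose S := [set z | z != 0 /\ f z <= f e0].
have Sfin : finite_set S.
  apply: sub_finite_set (@finite_int_bounded R n.+1
    (\sum_i \sum_k `|L i k| * (f e0 + 1))) => z /= [_ zf] i.
  have -> : (`|z i 0|%:~R : R) = `|(L *m (G *m map_mx intr z)) i 0|.
    by rewrite mulmxA LG mul1mx !mxE intr_norm.
  have fe0 : 0 <= f e0 by apply: sumr_ge0 => k _; exact: sqr_ge0.
  apply: (@le_trans _ _ (\sum_k `|L i k| * (f e0 + 1))).
    rewrite mxE (le_trans (ler_norm_sum _ _ _)) // ler_sum // => k _.
    rewrite normrM ler_wpM2l //.
    have le_f : (G *m map_mx intr z) k 0 ^+ 2 <= f e0.
      apply: le_trans zf; rewrite /f /sqn (bigD1 k) //= lerDl.
      by apply: sumr_ge0 => j _; exact: sqr_ge0.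
    by move: le_f; rewrite -real_normK ?num_real //; nra.
  rewrite (bigD1 i) //= lerDl; apply: sumr_ge0 => j _; apply: sumr_ge0 => k _.
  by rewrite mulr_ge0 ?addr_ge0.
have [|z [z0 zf] zmin] := finite_set_argmin f Sfin; first by exists e0; split.
exists z => // y y0; have [yf|yf] := leP (f y) (f e0); first exact: zmin.
exact: le_trans zf (ltW yf).
Qed.

Lemma unitmx_intr n (U : 'M[int]_n) :
  U \in unitmx -> (map_mx intr U : 'M[R]_n) \in unitmx.
Proof. rewrite !unitmxE det_map_mx; exact: rmorph_unit. Qed.

Lemma sqnZ m a (v : 'cV[R]_m) : sqn (a *: v) = a ^+ 2 * sqn v.
Proof. by rewrite mulr_sumr; apply: eq_bigr => k _; rewrite mxE exprMn. Qed.

Lemma sqn_gt0 m (v : 'cV[R]_m) : v != 0 -> 0 < sqn v.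
Proof.
have sq0 k : true -> 0 <= v k 0 ^+ 2 by rewrite sqr_ge0.
move=> v0; rewrite lt_def sumr_ge0 // andbT; apply: contraNneq v0 => /eqP.
rewrite psumr_eq0 // => /allP v0; apply/eqP/colP => k; rewrite mxE; apply/eqP.
by rewrite -sqrf_eq0; apply: v0; rewrite mem_index_enum.
Qed.

(** Pythagoras: the component along [g] is separated from the projection to the
    orthogonal complement of [g]. *)
Lemma sqn_project m (g h : 'cV[R]_m) (t : R) : g != 0 ->
  let w := (g^T *m h) 0 0 / sqn g in
  sqn (t *: g + h) = sqn g * (t + w) ^+ 2 + sqn (h - w *: g).
Proof.
move=> /sqn_gt0/lt0r_neq0 g0 w.
have wg : w * sqn g = \sum_k g k 0 * h k 0.
  by rewrite /w divfK // mxE; apply: eq_bigr => k _; rewrite mxE.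
have -> : sqn (t *: g + h) = t ^+ 2 * sqn g + 2 * t * (w * sqn g) + sqn h.
  rewrite wg /sqn !mulr_sumr -!big_split /=; apply: eq_bigr => k _.
  by rewrite !mxE; ring.
have -> : sqn (h - w *: g) = sqn h - 2 * w * (w * sqn g) + w ^+ 2 * sqn g.
  rewrite wg /sqn !mulr_sumr -sumrN -!big_split /=; apply: eq_bigr => k _.
  by rewrite !mxE; ring.
ring.
Qed.

(** Start the basis with a shortest vector [g] of the lattice, project the rest
    orthogonally to [g], and recurse. The existence of a left inverse expresses
    the independence of the columns of [G]; the lower rows
    of a left inverse for [g] and the other columns form one for the projections
    of the latter, although these no longer form a square matrix when [G] does. *)
Lemma korkine_zolotarev n m (G : 'M[R]_(m, n)) (L : 'M[R]_(n, m)) :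
  L *m G = 1%:M ->
  exists (U : 'M[int]_n) (N : 'M[R]_n) (d : 'cV[R]_n),
  [/\ U \in unitmx, upper_unitri N, forall i, 0 < d i 0,
      forall x, sqn (G *m (map_mx intr U *m x)) =
        \sum_l d l 0 * (N *m x) l 0 ^+ 2 &
      kz_reduced N d].
Proof.
elim: n G L => [|n IHn] G L LG.
  exists 1%:M, 1%:M, 0; split; rewrite ?unitmx1 //; try by case.
  move=> x; rewrite (flatmx0 (_ *m x)) mulmx0 big_ord0 /sqn big1 // => k _.
  by rewrite mxE expr0n.
have [z0 z0N0 z0min] := shortest_vector LG.
have [V Vu [c z0V]] := column_clearing z0.
pose VR : 'M[R]_n.+1 := map_mx intr V.
have VRu : VR \in unitmx by exact: unitmx_intr.
have [G1 G1E] : {G1 : 'M[R]_(m, 1 + n) | G1 = G *m VR} by exists (G *m VR).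
have [L1 L1E] : {L1 : 'M[R]_(1 + n, m) | L1 = invmx VR *m L}.
  by exists (invmx VR *m L).
have LG1 : L1 *m G1 = 1%:M.
  by rewrite L1E G1E mulmxA -[_ *m L *m G]mulmxA LG mulmx1 mulVmx.
pose g := lsubmx G1; pose G' := rsubmx G1.
have [Lg1 _ Lg0 LG'] : [/\ usubmx L1 *m g = 1%:M, usubmx L1 *m G' = 0,
    dsubmx L1 *m g = 0 & dsubmx L1 *m G' = 1%:M].
  apply: eq_block_mx; rewrite -mul_col_row vsubmxK hsubmxK LG1.
  by rewrite -scalar_mx_block.
have g0 : g != 0.
  apply: contraTneq (oner_neq0 R) => g0; rewrite negbK.
  by have /matrixP/(_ 0 0) := Lg1; rewrite g0 mulmx0 !mxE => /esym/eqP.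
(* [g] is at most as long as [z0], which is an integer multiple of it. *)
have gmin (y : 'cV[int]_(1 + n)) : y != 0 -> sqn g <= sqn (G1 *m map_mx intr y).
  move=> y0; have c0 : c != 0.
    by apply: contraNneq z0N0 => c0; rewrite z0V c0 scale0r mulmx0.
  have GV (y' : 'cV[int]_n.+1) :
      G *m map_mx intr (V *m y') = G1 *m map_mx intr y'.
    by rewrite map_mxM mulmxA -G1E.
  apply: (@le_trans _ _ (sqn (G *m map_mx intr z0))).
    have -> : G *m map_mx intr z0 = c%:~R *: g.
      rewrite z0V GV map_mxZ map_delta_mx -scalemxAr -colE; congr (_ *: _).
      by apply/colP => k; rewrite !mxE; congr (G1 _ _); apply: val_inj.
    rewrite sqnZ; apply: ler_peMl; first exact: ltW (sqn_gt0 g0).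
    rewrite -rmorphXn /= ler1z.
    by rewrite -gtz0_ge1 exprn_even_gt0.
  rewrite -GV; apply: z0min; apply: contraNneq y0 => Vy0.
  by rewrite -(mulKmx Vu y) Vy0 mulmx0.
(* [w] lists the Gram-Schmidt coefficients of the other columns along [g], and
   [G2] consists of their projections. *)
pose w := (sqn g)^-1 *: (g^T *m G').
pose G2 := G' - g *m w.
have key (t : 'cV[R]_1) (y : 'cV[R]_n) : sqn (G1 *m col_mx t y) =
    sqn g * (t + w *m y) 0 0 ^+ 2 + sqn (G2 *m y).
  rewrite -{1}[G1]hsubmxK mul_row_col [t in LHS]mx11_scalar mul_mx_scalar.
  have wy : (w *m y) 0 0 = (g^T *m (G' *m y)) 0 0 / sqn g.
    by rewrite -scalemxAl mulrC mulmxA mxE.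
  rewrite sqn_project // -/g -/G' -wy [(t + _) 0 0]mxE.
  rewrite [G2 *m y]mulmxBl -[g *m w *m y]mulmxA.
  by rewrite [X in g *m X]mx11_scalar mul_mx_scalar.
have LG2 : dsubmx L1 *m G2 = 1%:M.
  by rewrite mulmxBr mulmxA Lg0 mul0mx subr0.
have [U' [N' [d' [U'u N'tri d'0 G2E KZ']]]] := IHn _ _ LG2.
pose UR' : 'M[R]_n := map_mx intr U'.
pose U1 : 'M[int]_(1 + n) := block_mx 1%:M 0 0 U'.
pose N : 'M[R]_(1 + n) := block_mx 1%:M (w *m UR') 0 N'.
pose d : 'cV[R]_(1 + n) := col_mx (sqn g)%:M d'.
have d_0 (i : 'I_1) : d (lshift n i) 0 = sqn g.
  by rewrite /d col_mxEu ord1 mxE eqxx.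
have d_S (i : 'I_n) : d (rshift 1 i) 0 = d' i 0 by rewrite /d col_mxEd.
have N_0 x (i : 'I_1) :
    (N *m x) (lshift n i) 0 = (usubmx x + w *m (UR' *m dsubmx x)) 0 0.
  by rewrite -{1}[x]vsubmxK mul_block_col mul1mx ord1 col_mxEu mulmxA.
have N_S (x : 'cV[R]_(1 + n)) (i : 'I_n) :
    (N *m x) (rshift 1 i) 0 = (N' *m dsubmx x) i 0.
  by rewrite -{1}[x]vsubmxK mul_block_col mul0mx add0r col_mxEd.
have Ntri : @upper_unitri (1 + n) N.
  move=> i j; case: (@split_ordP 1 n i) => i' ->.
    case: (@split_ordP 1 n j) => j' ->; last by rewrite !ord1.
    by move=> _; rewrite /N !ord1 block_mxEul mxE.
  case: (@split_ordP 1 n j) => j' ->.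
    by move=> _; rewrite /N block_mxEdl mxE eq_rlshift.
  rewrite leq_add2l /N block_mxEdr => /N'tri ->.
  by rewrite (inj_eq (@rshift_inj _ _)).
have U1u : U1 \in unitmx by rewrite unitmxE det_ublock det1 mul1r -unitmxE.
have quad (x : 'cV[R]_(1 + n)) : sqn (G1 *m (map_mx intr U1 *m x)) =
    \sum_l d l 0 * (N *m x) l 0 ^+ 2.
  rewrite big_split_ord big_ord1 /= d_0 N_0.
  under eq_bigr do rewrite d_S N_S.
  rewrite -G2E -{1}[x]vsubmxK /U1 map_block_mx map_mx1 !map_mx0.
  by rewrite mul_block_col mul1mx !mul0mx addr0 add0r key.
have KZ (i : 'I_(1 + n)) (z : 'cV[int]_(1 + n)) :
    (exists2 l : 'I_(1 + n), (i <= l)%N & z l 0 != 0) ->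
    d i 0 <= \sum_(l < 1 + n | (i <= l)%N) d l 0 * (N *m map_mx intr z) l 0 ^+ 2.
  case: (@split_ordP 1 n i) => i' -> [l il zl].
    rewrite d_0 (eq_bigl xpredT) => [|k]; last by rewrite ord1.
    rewrite -quad -map_mxM; apply: gmin; apply: contraNneq zl => U1z.
    by rewrite -[z](mulKmx U1u) U1z mulmx0 mxE.
  rewrite big_split_ord big_pred0 /= => [|k]; last by rewrite ord1.
  rewrite add0r d_S (eq_big (fun l : 'I_n => (i' <= l)%N)
    (fun l => d' l 0 *
      (N' *m map_mx intr (dsubmx (z : 'cV_(1 + n)))) l 0 ^+ 2)); first last.
  + by move=> k _; rewrite d_S N_S map_dsubmx.
  + by move=> k; rewrite leq_add2l.
  apply: KZ'; move: il zl.
  case: (@split_ordP 1 n l) => l' ->; first by rewrite ord1.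
  by rewrite leq_add2l => il zl; exists l' => //; rewrite mxE.
exists (V *m U1), N, d; split.
- by rewrite unitmx_mul Vu.
- exact: Ntri.
- move=> i; case: (@split_ordP 1 n i) => i' ->; first by rewrite d_0 sqn_gt0.
  by rewrite d_S.
- by move=> x; rewrite -quad G1E map_mxM !mulmxA.
- exact: KZ.
Qed.

End KorkineZolotarev.

(** * Minkowski's theorem and the decay of reduced forms *)

Section Decay.
Variable R : realType.

Lemma upper_unitri_zero_above n (N : 'M[R]_n) (x : 'cV[R]_n) (l : 'I_n) :
  upper_unitri N -> (forall j : 'I_n, (l <= j)%N -> x j 0 = 0) ->
  (N *m x) l 0 = 0.
Proof.
move=> Ntri x0; rewrite mxE big1 // => j _; have [lj|jl] := leqP l j.
  by rewrite x0 ?mulr0.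
by rewrite Ntri ?(ltnW jl) // -val_eqE /= gtn_eqF ?mul0r.
Qed.

(** Triangularity lets the coordinates of [z] be chosen from the last one
    upwards: [z l 0] shifts the [l]-th entry of [N *m z] by an integer and leaves
    the later ones unchanged. *)
Lemma prescribed_floors n (N : 'M[R]_n) (S : pred 'I_n) (c : 'I_n -> int) :
  upper_unitri N ->
  exists2 z : 'cV[int]_n, (forall l, ~~ S l -> z l 0 = 0) &
    forall l, S l -> Num.floor ((N *m map_mx intr z) l 0) = c l.
Proof.
move=> Ntri.
suff claim m : exists2 z : 'cV[int]_n, (forall l, ~~ S l -> z l 0 = 0) &
    forall l : 'I_n, (n - m <= l)%N -> S l ->
      Num.floor ((N *m map_mx intr z) l 0) = c l.
  have [z z0 zc] := claim n; exists z => // l; apply: zc; by rewrite subnn.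
elim: m => [|m [z z0 zc]].
  exists 0 => [l _|l]; first by rewrite mxE.
  by rewrite subn0 leqNgt ltn_ord.
have [nm|mn] := leqP n m.
  by exists z => // l _; apply: zc; move: nm; rewrite -subn_eq0 => /eqP ->.
have jn : (n - m.+1 < n)%N by lia.
pose j := Ordinal jn.
have [Sj|Sj] := boolP (S j); last first.
  exists z => // l jl Sl; apply: zc => //; move: jl; rewrite leq_eqVlt.
  case/predU1P => [jl|]; last by rewrite -ltnS; lia.
  by move: Sj; rewrite (_ : j = l) ?Sl //; apply: val_inj.
pose a : int := c j - Num.floor ((N *m map_mx intr z) j 0).
have NE l : (N *m map_mx intr (z + a *: delta_mx j 0)) l 0 =
    (N *m map_mx intr z) l 0 + a%:~R * N l j.
  rewrite map_mxD map_mxZ map_delta_mx mulmxDr mxE; congr (_ + _).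
  by rewrite -scalemxAr -colE !mxE.
exists (z + a *: delta_mx j 0) => [l Sl|l jl Sl].
  rewrite !mxE z0 // add0r; case: eqVneq => [lj|]; last by rewrite mulr0.
  by move: Sl; rewrite lj Sj.
rewrite NE; move: jl; rewrite leq_eqVlt => /predU1P[jl|jl].
  have -> : l = j by apply: val_inj.
  rewrite Ntri // eqxx mulr1 floorDrz ?intr_int //= intrKfloor /a; ring.
rewrite Ntri ?(ltnW jl) // -val_eqE /= gtn_eqF // mulr0 addr0 zc //.
by move: jl; lia.
Qed.

(** Minkowski's theorem for a triangular lattice, by the pigeonhole principle. For
    large [M] there are [M^#|S|] vectors [z] supported on [S] whose entries
    [(N z)_l], for [l] in [S], have prescribed integer parts smaller than [M];
    cutting the interval from 0 to [M] into pieces of length [s / r l] gives at most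
    [\prod_l (2 M r_l / s)] cells, which is fewer, and the difference of two
    vectors in one cell is the required [z]. *)
Lemma short_vector_triangular n (N : 'M[R]_n) (r : 'I_n -> R)
    (S : pred 'I_n) (s : R) :
  upper_unitri N -> (forall l, 0 < r l) -> 0 < s ->
  \prod_(l | S l) (2 * r l / s) < 1 ->
  exists z : 'cV[int]_n, [/\ z != 0, forall l, ~~ S l -> z l 0 = 0 &
    forall l, S l -> r l * `|(N *m map_mx intr z) l 0| <= s].
Proof.
move=> Ntri r0 s0 small.
(* [M] is so large that [M * (r l / s) >= 1], hence its integer part
   plus 1 is at most twice as large. *)
have [M M0 Mr] : exists2 M : nat, (0 < M)%N & forall l, 1 <= M%:R * (r l / s).
  exists (Num.truncn (\sum_l s / r l)).+1 => // l.
  have rs : 0 < r l / s by rewrite divr_gt0.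
  rewrite -ler_pdivrMr // mul1r invf_div.
  apply: le_trans (ltW (truncnS_gt _)).
  by rewrite (bigD1 l) //= lerDl sumr_ge0 // => j _; rewrite divr_ge0 // ltW.
pose p l := if S l then M else 1%N.
pose q l := if S l then (Num.truncn (M%:R * (r l / s))).+1 else 1%N.
have qp : (\prod_l q l < \prod_l p l)%N.
  rewrite -(ltr_nat R) !natr_prod.
  apply: (@le_lt_trans _ _ (\prod_l ((p l)%:R * if S l then 2 * r l / s else 1))).
    apply: ler_prod => l _; rewrite ler0n /= /q /p.
    case: ifP => Sl; last by rewrite mulr1.
    have -> : M%:R * (2 * r l / s) = 2 * (M%:R * (r l / s)) by ring.
    move: (M%:R * _) (Mr l) => t t1.
    have : (Num.truncn t)%:R <= t by rewrite truncn_le; lra.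
    by rewrite -natr1; lra.
  rewrite big_split /= -[X in _ < X]mulr1 ltr_pM2l.
    by rewrite -big_mkcond.
  by apply: prodr_gt0 => l _; rewrite ltr0n /p; case: ifP.
have [B BE Bcard] := nat_box_fset p.
have [D DE Dcard] := nat_box_fset q.
have /choice[z zP] (c : 'cV[nat]_n) : exists z : 'cV[int]_n,
    (forall l, ~~ S l -> z l 0 = 0) /\
    forall l, S l -> Num.floor ((N *m map_mx intr z) l 0) = (c l 0)%:Z.
  by have [z] := prescribed_floors S (fun l => (c l 0)%:Z) Ntri; exists z.
pose y c l := (N *m map_mx intr (z c)) l 0.
pose cell c : 'cV[nat]_n :=
  \col_l if S l then Num.truncn (y c l * (r l / s)) else 0%N.
have y0 c l : S l -> 0 <= y c l.
  by move=> Sl; rewrite -floor_ge0 (zP c).2.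
have cellD c : c \in B -> cell c \in D.
  rewrite BE DE => /forallP cp; apply/forallP => l; rewrite mxE /q.
  have := cp l; rewrite /p; case: ifP => // Sl cM; rewrite ltnS.
  apply: le_truncn; rewrite ler_wpM2r ?divr_ge0 ?(ltW (r0 l)) ?(ltW s0) //.
  apply: (@le_trans _ _ (c l 0).+1%:R); last by rewrite ler_nat.
  have := floorD1_gt (y c l); rewrite (zP c).2 // intrD => /ltW.
  by rewrite -natr1.
have [c [c' [cB c'B cc' cells]]] : exists c c', [/\ c \in B, c' \in B, c != c' &
    cell c = cell c'].
  apply: contrapT => noc; move: qp; rewrite -Bcard -Dcard ltnNge => /negP; apply.
  apply: (leq_card_fset cellD) => c c' cB c'B cells.
  apply/eqP; apply: contraT => cc'.
  by case: noc; exists c, c'.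
exists (z c - z c'); split.
- apply: contra cc'; rewrite subr_eq0 => /eqP zz; apply/eqP/colP => l.
  have [Sl|Sl] := boolP (S l).
    by have := (zP c).2 l Sl; rewrite zz (zP c').2 // => -[].
  move: cB c'B; rewrite !BE => /forallP/(_ l) + /forallP/(_ l).
  by rewrite /p (negPf Sl) !ltnS !leqn0 => /eqP -> /eqP ->.
- by move=> l Sl; rewrite !mxE (zP c).1 // (zP c').1 // subrr.
move=> l Sl.
have -> : (N *m map_mx intr (z c - z c')) l 0 = y c l - y c' l.
  by rewrite map_mxB mulmxBr /y mxE [X in _ + X]mxE.
have : cell c l 0 = cell c' l 0 by rewrite cells.
rewrite !mxE Sl => /eqP; rewrite truncn_eq; last first.
  by rewrite mulr_ge0 ?y0 ?divr_ge0 ?(ltW (r0 l)) ?(ltW s0).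
have rs : 0 < r l / s by rewrite divr_gt0.
have /truncn_itv : 0 <= y c' l * (r l / s) by rewrite mulr_ge0 ?y0 // ltW.
rewrite -!natr1; move: (Num.truncn _)%:R => t /andP[t1 t2] /andP[t3 t4].
suff : `|(y c l - y c' l) * (r l / s)| <= 1.
  by rewrite normrM (gtr0_norm rs) mulrA ler_pdivrMr // mul1r mulrC.
by rewrite mulrBl ler_norml; apply/andP; split; lra.
Qed.

End Decay.

Section KZDecay.
Variable R : realType.

Lemma inv_le_ln_diff m : (0 < m)%N -> m.+1%:R^-1 <= ln m.+1%:R - ln m%:R :> R.
Proof.
move=> m0; have m0' : 0 < m%:R :> R by rewrite ltr0n.
have m1' : 0 < m.+1%:R :> R by rewrite ltr0n.
have lt1 : -1 < - m.+1%:R^-1 :> R by rewrite ltrN2 invf_lt1 // ltr1n ltnS.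
have := le_ln1Dx lt1.
have -> : 1 + - m.+1%:R^-1 = m%:R / m.+1%:R :> R.
  by rewrite -natr1 in m1' *; field; rewrite gt_eqF.
rewrite ln_div ?posrE //; move: (ln _) (ln _) (_^-1) => a b c; lra.
Qed.

(** The hypothesis bounds [b m] by [g] plus the mean of [b 0, ..., b m]. Solving
    it for [b m] shows that appending [b m] raises the mean by at most [g / m],
    so the means grow at most like [g] times the harmonic sum. *)
Lemma decay_of_averages (b : nat -> R) (g : R) (M : nat) : 0 <= g ->
  (forall m, (m <= M)%N -> m.+1%:R * b m <= m.+1%:R * g + \sum_(j < m.+1) b j) ->
  forall m, (m <= M)%N -> b m <= b 0%N + g * (2 + ln m%:R).
Proof.
move=> g0 avg.
pose A m := (\sum_(j < m.+1) b j) / m.+1%:R.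
have bA m : (m <= M)%N -> b m <= g + A m.
  move=> /avg; rewrite /A => avgm.
  rewrite -(ler_pM2l (_ : 0 < m.+1%:R)) ?ltr0n // mulrDr mulrCA divff ?mulr1 //.
have AS m : A m.+1 = (m.+1%:R * A m + b m.+1) / m.+2%:R.
  by rewrite /A big_ord_recr /= mulrCA divff ?mulr1.
have Abound m : (m <= M)%N -> A m <= b 0%N + g * ((0 < m)%N%:R + ln m%:R).
  elim: m => [_|m IHm mM].
    by rewrite /A big_ord1 divr1 ln0 // !addr0 mulr0 addr0.
  have Am := IHm (ltnW mM).
  have step : A m.+1 <= A m + g / m.+1%:R.
    have := bA _ mM; rewrite AS; set a := A m; set c := b m.+1.
    have m1 : 0 < m.+1%:R :> R by rewrite ltr0n.
    rewrite -[m.+2%:R]natr1; move: m.+1%:R m1 => t t0.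
    have t1 : t + 1 != 0 by rewrite gt_eqF // addr_gt0.
    have -> : (t * a + c) / (t + 1) = a + (c - a) / (t + 1) by field.
    rewrite lerD2l ler_pdivlMr //; set u := (c - a) / (t + 1).
    have : c - a = u * (t + 1) by rewrite divfK.
    lra.
  apply: (le_trans step).
  have [m0|m0] := posnP m.
    move: Am; rewrite m0 ln0 // ln1 divr1 /= mulr0n mulr1n; lra.
  have : 0 <= g * (ln m.+1%:R - ln m%:R - m.+1%:R^-1).
    by rewrite mulr_ge0 // subr_ge0 inv_le_ln_diff.
  move: Am; rewrite m0 /= mulr1n.
  move: (A m) (ln m%:R) (ln m.+1%:R) (m.+1%:R^-1) => t x y z.
  lra.
move=> m mM; apply: le_trans (bA m mM) _.
have : 0 <= g * (1 - (0 < m)%N%:R) by rewrite mulr_ge0 // subr_ge0 lern1 leq_b1.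
have := Abound m mM; move: (A m) (ln _) (nat_of_bool _)%:R => x y z; lra.
Qed.

Lemma sum_window (V : nmodType) n (F : nat -> V) (k : 'I_n) m : (m <= k)%N ->
  \sum_(l < n | (k - m <= l <= k)%N) F l = \sum_(j < m.+1) F (k - j)%N.
Proof.
elim: m => [_|m IHm mk].
  rewrite big_ord1 subn0 (big_pred1 k) // => l /=.
  by rewrite -eqn_leq -val_eqE eq_sym.
have kmn : (k - m.+1 < n)%N by have := ltn_ord k; lia.
rewrite (bigD1 (Ordinal kmn)) /=; last by lia.
rewrite big_ord_recr /= -IHm ?(ltnW mk) // addrC; congr (_ + _).
by apply: eq_bigl => l; rewrite -val_eqE /=; lia.
Qed.

(** Applying Minkowski's theorem to the coordinates from [i] to [k] bounds the
    logarithm of [d i 0] by [ln (9 n)] plus the mean of the logarithms of the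
    entries of [d] between [i] and [k]; the entries are then averaged starting
    from [k] and going down. *)
Lemma kz_decay n (N : 'M[R]_n) (d : 'cV[R]_n) :
  upper_unitri N -> (forall i, 0 < d i 0) -> kz_reduced N d ->
  forall i k : 'I_n, (i <= k)%N ->
    d i 0 <= d k 0 * expR (ln (9 * n%:R) * (2 + ln n%:R)).
Proof.
have q0 : 0 <= 2 / 3 :> R by lra.
have q1 : 2 / 3 < 1 :> R by lra.
move=> Ntri d0 KZ.
have n0 (i : 'I_n) : (0 < n)%N by apply: leq_ltn_trans (ltn_ord i).
have local (i k : 'I_n) : (i <= k)%N ->
    (k - i).+1%:R * ln (d i 0) <= (k - i).+1%:R * ln (9 * n%:R) +
      \sum_(l < n | (i <= l <= k)%N) ln (d l 0).
  move=> ik; pose S := [pred l : 'I_n | (i <= l <= k)%N].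
  pose avg := (\sum_(l | S l) ln (d l 0)) / (k - i).+1%:R.
  have cardS : #|S| = (k - i).+1.
    have := @sum_window nat n (fun=> 1%N) k (k - i)%N (leq_subr _ _).
    by rewrite subKn // !sum1_card card_ord.
  pose r l := expR (ln (d l 0) / 2).
  have rsq l : r l ^+ 2 = d l 0.
    by rewrite /r -expRM_natl mulrC divfK ?lnK ?posrE ?pnatr_eq0.
  (* Any constant larger than 2 in place of 3 makes the product below small. *)
  pose s : R := 3 * expR (avg / 2).
  have s0 : 0 < s by rewrite mulr_gt0 ?expR_gt0.
  have small : \prod_(l | S l) (2 * r l / s) < 1.
    rewrite (eq_bigr (fun l =>
        2 / 3 * expR (ln (d l 0) / 2 - avg / 2))); last first.
      by move=> l _; rewrite expRB /s /r; field; rewrite gt_eqF ?expR_gt0.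
    rewrite big_split /= prodr_const cardS -expR_sum sumrB -mulr_suml.
    rewrite sumr_const cardS -[_ *+ (k - i).+1]mulr_natr mulrAC.
    by rewrite /avg divfK // subrr expR0 mulr1 exprn_ilt1.
  have [z [z0 zS zs]] :=
    short_vector_triangular Ntri (fun l => expR_gt0 _) s0 small.
  have dle : d i 0 <= n%:R * s ^+ 2.
    have [l0 zl0] : exists l, z l 0 != 0.
      apply/existsP; apply: contraNT z0; rewrite negb_exists => /forallP z0.
      by apply/eqP/colP => l; rewrite mxE; apply/eqP; have := z0 l; rewrite negbK.
    apply: le_trans (KZ i z _) _.
      exists l0 => //; move: zl0; apply: contraNT => il0; apply/eqP/zS => /=.
      by rewrite (negPf il0).
    apply: (@le_trans _ _ (\sum_(l < n | (i <= l)%N) s ^+ 2)); last first.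
      rewrite mulr_natl -[n in _ *+ n]card_ord -sumr_const big_mkcond.
      rewrite ler_sum // => l _.
      by case: ifP => _; rewrite ?sqr_ge0.
    apply: ler_sum => l il; have [lk|kl] := leqP l k.
      have /zs : S l by rewrite /= il.
      move=> rs; rewrite -rsq.
      rewrite -(real_normK (num_real ((N *m map_mx intr z) l 0))) -exprMn.
      have r0 : 0 <= r l by exact: expR_ge0.
      by apply: lerXn2r; rewrite ?nnegrE ?(ltW s0) ?mulr_ge0.
    rewrite upper_unitri_zero_above // ?expr0n ?mulr0 ?sqr_ge0 // => j lj.
    by rewrite mxE zS //= negb_and -!ltnNge (leq_trans kl) ?orbT.
  have n0' : 0 < n%:R :> R by rewrite ltr0n (n0 i).
  have : ln (d i 0) <= ln (9 * n%:R) + avg.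
    rewrite -ler_expR lnK ?posrE // expRD lnK ?posrE ?mulr_gt0 //.
    apply: le_trans dle _.
    rewrite /s exprMn -expRM_natl [2%:R * _]mulrC divfK ?pnatr_eq0 //.
    by rewrite le_eqVlt; apply/orP; left; apply/eqP; ring.
  rewrite -(ler_pM2l (_ : 0 < (k - i).+1%:R)) ?ltr0n // mulrDr.
  by rewrite [X in _ + X]mulrC divfK.
move=> i k ik.
pose F j := if insub j is Some l then ln (d l 0) else 0.
have FE (l : 'I_n) : F l = ln (d l 0) by rewrite /F valK.
have g0 : 0 <= ln (9 * n%:R) :> R.
  by rewrite ln_ge0 // -natrM ler1n muln_gt0 (n0 i).
have avg m : (m <= k)%N -> m.+1%:R * F (k - m)%N <=
    m.+1%:R * ln (9 * n%:R) + \sum_(j < m.+1) F (k - j)%N.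
  move=> mk; have lt : (k - m < n)%N by have := ltn_ord k; lia.
  rewrite -(sum_window _ mk) (FE (Ordinal lt)).
  have := local (Ordinal lt) k (leq_subr _ _); rewrite /= subKn //.
  by under [in X in _ -> X]eq_bigr do rewrite FE.
have := decay_of_averages g0 avg (leq_subr i k).
rewrite subKn // subn0 !FE => lnle.
rewrite -[leLHS]lnK ?posrE // -[d k 0]lnK ?posrE // -expRD ler_expR.
apply: (le_trans lnle); rewrite lerD2l ler_wpM2l // lerD2l.
have [->|ki] := posnP (k - i); first by rewrite ln0 // ln_ge0 // ler1n (n0 i).
rewrite ler_ln ?posrE ?ltr0n ?(n0 i) // ler_nat.
by have := ltn_ord k; lia.
Qed.
End KZDecay.

(** * Seysen's reduction of unitriangular matrices *)

Section Seysen.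
Variable R : realType.

Lemma upper_unitri_block n1 n2 (A : 'M[R]_n1) (B : 'M[R]_(n1, n2))
    (D : 'M[R]_n2) :
  upper_unitri A -> upper_unitri D -> upper_unitri (block_mx A B 0 D).
Proof.
move=> Atri Dtri i j.
case: (split_ordP i) => i' ->; case: (split_ordP j) => j' ->.
- by move=> ji; rewrite block_mxEul Atri // (inj_eq (@lshift_inj _ _)).
- by move=> /= ji; have := ltn_ord i'; lia.
- by rewrite block_mxEdl mxE eq_rlshift.
- rewrite leq_add2l => ji; rewrite block_mxEdr Dtri //.
  by rewrite (inj_eq (@rshift_inj _ _)).
Qed.

Lemma block_entry_bound n1 n2 (A : 'M[R]_n1) (B : 'M[R]_(n1, n2))
    (D : 'M[R]_n2) (s : R) :
  0 <= s -> (forall i j, `|A i j| <= s) -> (forall i j, `|B i j| <= s) ->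
  (forall i j, `|D i j| <= s) -> forall i j, `|block_mx A B 0 D i j| <= s.
Proof.
move=> s0 As Bs Ds i j.
case: (split_ordP i) => i' ->; case: (split_ordP j) => j' ->.
- by rewrite block_mxEul.
- by rewrite block_mxEur.
- by rewrite block_mxEdl mxE normr0.
- by rewrite block_mxEdr.
Qed.

(** Split [N] into blocks [A B; 0 D] of half the size. After reducing [A] and [D],
    an integer combination [W] of the first columns is added to the last ones so
    that the corner becomes [A E] with [E] bounded by 1; the corner of the inverse
    is then [- E D^-1]. Each of the two is a product of a bounded matrix and a
    matrix already controlled, so one level of recursion costs a factor [M]. *)
Lemma seysen (M k n : nat) (N : 'M[R]_n) :
  (n <= 2 ^ k)%N -> (n <= M)%N -> (0 < M)%N -> upper_unitri N ->
  exists (U : 'M[int]_n) (N' : 'M[R]_n),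
  [/\ U \in unitmx, upper_unitri (N *m map_mx intr U), upper_unitri N',
      N' *m (N *m map_mx intr U) = 1%:M &
      forall i j, `|(N *m map_mx intr U) i j| <= M%:R ^+ k /\
                  `|N' i j| <= M%:R ^+ k].
Proof.
move=> + + M0; elim: k n N => [|k IHk] n N nk nM Ntri.
  have N1 : N = 1%:M.
    apply/matrixP => i j; rewrite Ntri ?mxE //.
    by have := ltn_ord i; have := ltn_ord j; lia.
  exists 1%:M, 1%:M; rewrite map_mx1 mulmx1 N1 mulmx1 unitmx1.
  have tri1 : upper_unitri (1%:M : 'M[R]_n) by move=> i j _; rewrite mxE.
  by split=> // i j; rewrite mxE expr0 normr_nat lern1 leq_b1.
have [n1 [n2 [nE n1k n2k]]] : exists n1 n2,
    [/\ n = (n1 + n2)%N, (n1 <= 2 ^ k)%N & (n2 <= 2 ^ k)%N].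
  exists (minn n (2 ^ k)), (n - minn n (2 ^ k))%N; move: nk; rewrite expnS.
  by move: (2 ^ k)%N => a na; split; lia.
subst n; rewrite -[N]submxK in Ntri *.
set A := ulsubmx N in Ntri *; set B := ursubmx N in Ntri *.
set D := drsubmx N in Ntri *.
have C0 : dlsubmx N = 0.
  apply/matrixP => i j; rewrite [RHS]mxE -(block_mxEdl A B _ D) Ntri.
    by rewrite eq_rlshift.
  by rewrite /= ltnW // ltn_addr.
rewrite C0 in Ntri *.
have Atri : upper_unitri A.
  by move=> i j ji; rewrite -(block_mxEul A B 0 D) Ntri.
have Dtri : upper_unitri D.
  move=> i j ji; rewrite -(block_mxEdr A B 0 D) Ntri ?leq_add2l //.
  by rewrite (inj_eq (@rshift_inj _ _)).
have n1M : (n1 <= M)%N by lia.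
have n2M : (n2 <= M)%N by lia.
have [U1 [A' [U1u AUtri A'tri A'A As]]] := IHk _ _ n1k n1M Atri.
have [U2 [D' [U2u DUtri D'tri D'D Ds]]] := IHk _ _ n2k n2M Dtri.
set AU := A *m map_mx intr U1 in AUtri A'A As.
set DU := D *m map_mx intr U2 in DUtri D'D Ds.
have [Y YE] : {Y : 'M[R]_(n1, n2) | Y = A' *m (B *m map_mx intr U2)} by eexists.
(* Rounding, so that the entries of [E] are fractional parts. *)
pose W : 'M[int]_(n1, n2) := - map_mx Num.floor Y.
pose E : 'M[R]_(n1, n2) := map_mx intr W + Y.
have E01 i j : `|E i j| <= 1.
  rewrite !mxE rmorphN /= addrC ger0_norm ?subr_ge0 ?floor_le // lerBlDr.
  by have := floorD1_gt (Y i j); rewrite intrD addrC => /ltW.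
have AA' : AU *m A' = 1%:M by exact: mulmx1C.
pose U := block_mx U1 (U1 *m W) 0 U2.
have NUE : block_mx A B 0 D *m map_mx intr U = block_mx AU (AU *m E) 0 DU.
  rewrite /U map_block_mx map_mx0 mulmx_block !mulmx0 !mul0mx !addr0 add0r.
  rewrite map_mxM [A *m (_ *m _)]mulmxA -/AU -/DU mulmxDr.
  congr (block_mx _ (_ + _) _ _).
  by rewrite YE mulmxA AA' mul1mx.
have Mk0 : 0 <= M%:R ^+ k :> R by rewrite exprn_ge0.
have MkS : M%:R ^+ k <= M%:R ^+ k.+1 :> R by rewrite exprS ler_peMl // ler1n.
have prod_bound p q r (X : 'M[R]_(p, q)) (Z : 'M[R]_(q, r)) (a b : R) :
    (q <= M)%N -> a * b = M%:R ^+ k -> (forall i j, `|X i j| <= a) ->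
    (forall i j, `|Z i j| <= b) -> forall i j, `|(X *m Z) i j| <= M%:R ^+ k.+1.
  move=> qM ab Xa Zb i j; rewrite mxE (le_trans (ler_norm_sum _ _ _)) //.
  apply: (@le_trans _ _ (\sum_(l < q) M%:R ^+ k)).
    by apply: ler_sum => l _; rewrite normrM -ab ler_pM.
  by rewrite sumr_const card_ord exprS -[leLHS]mulr_natl ler_wpM2r // ler_nat.
exists U, (block_mx A' (- (E *m D')) 0 D'); rewrite NUE; split.
- by rewrite unitmxE det_ublock unitrM -!unitmxE U1u.
- exact: upper_unitri_block.
- exact: upper_unitri_block.
- rewrite mulmx_block !mulmx0 !mul0mx !addr0 add0r A'A D'D mulmxA A'A mul1mx.
  by rewrite mulNmx -mulmxA D'D mulmx1 subrr -scalar_mx_block.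
move=> i j; split; apply: block_entry_bound => //.
- by move=> a b; apply: le_trans MkS; case: (As a b).
- apply: (prod_bound _ _ _ _ _ (M%:R ^+ k) 1); rewrite ?mulr1 //.
  by move=> a b; case: (As a b).
- by move=> a b; apply: le_trans MkS; case: (Ds a b).
- by move=> a b; apply: le_trans MkS; case: (As a b).
- move=> a b; rewrite mxE normrN.
  apply: (prod_bound _ _ _ _ _ 1 (M%:R ^+ k)); rewrite ?mul1r //.
  by move=> c e; case: (Ds c e).
- by move=> a b; apply: le_trans MkS; case: (Ds a b).
Qed.

End Seysen.

(** * Comparison of a body with a coordinate box *)

Section Containment.
Variable R : realType.

Lemma det_le (n : nat) (r : R) (X : 'M[R]_n) :
  (forall i j, `|X i j| <= r) -> `|\det X| <= \sum_(s : 'S_n) r ^+ n.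
Proof.
move=> Xr; apply: le_trans (ler_norm_sum _ _ _) _; apply: ler_sum => s _.
rewrite normrM normrX normrN1 expr1n mul1r normr_prod.
rewrite -[n in _ ^+ n]card_ord -prodr_const.
by apply: ler_prod => i _; rewrite normr_ge0 Xr.
Qed.

(** For [X] with columns in [K] and a determinant of absolute value at least half the
    supremum, replacing a column by a point of [K] at most doubles that value, so by
    Cramer's rule the coordinates of that point are at most 2. *)
Lemma near_auerbach n (K : set 'cV[R]_n) : symmetric_convex_body K ->
  exists X : 'M[R]_n, [/\ X \in unitmx, forall j, K (col j X) &
    forall x, K x -> forall i, `|(invmx X *m x) i 0| <= 2].
Proof.
move=> Kb; have [r r0 Kr] := body_bounded Kb.
have [eps eps0 Keps] := body_scaled_basis Kb.
pose E := [set `|\det X| | X in [set X : 'M[R]_n | forall j, K (col j X)]].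
have Eub : has_ubound E.
  exists (\sum_(s : 'S_n) r ^+ n) => _ [X KX <-]; apply: det_le => i j.
  by have := Kr _ (KX j) i; rewrite mxE.
have Eeps : E (eps ^+ n).
  exists eps%:M; last by rewrite det_scalar ger0_norm // exprn_ge0 // ltW.
  move=> j; have := Keps j; congr (K _); apply/colP => i.
  by rewrite !mxE eqxx andbT mulr_natr.
have supE : has_sup E by split=> //; exists (eps ^+ n).
have sup0 : 0 < sup E.
  by apply: lt_le_trans (ub_le_sup Eub Eeps); rewrite exprn_gt0.
have [_ [X KX <-] supX] := sup_adherent (divr_gt0 sup0 (@ltr0n R 2)) supE.
have dX : 0 < `|\det X| by apply: lt_trans supX; lra.
have Xu : X \in unitmx by rewrite unitmxE unitfE -normr_gt0.
exists X; split => // x Kx k.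
have : `|\det (replace_col k X x)| <= sup E.
  apply: ub_le_sup => //; exists (replace_col k X x) => // j.
  have [->|jk] := eqVneq j k.
    by congr (K _): Kx; apply/colP => i; rewrite !mxE eqxx.
  by have := KX j; congr (K _); apply/colP => i; rewrite !mxE (negPf jk).
rewrite -{1}(mulKVmx Xu x) cramer_coord normrM => le_sup.
rewrite -(ler_pM2l dX); apply: (le_trans le_sup); lra.
Qed.

(** With [L = ln n >= ln 2 >= 1/2], the logarithm of the left-hand side is at most
    [2 L^2 + 8 L^2 + 8 L^2 + 25 L^2]. *)
Lemma containment_factor_bound n k :
  (1 < n)%N -> (n <= 2 ^ k)%N -> (2 ^ k.-1 < n)%N ->
  2 * n%:R ^+ 4 * (n%:R ^+ k) ^+ 2 * expR (ln (9 * n%:R) * (2 + ln n%:R))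
    <= n%:R `^ (50 * ln n%:R) :> R.
Proof.
move=> n1 nk kn.
have n0 : 0 < n%:R :> R by rewrite ltr0n ltnW.
have ln2 : 2^-1 <= ln 2 :> R.
  by have := @inv_le_ln_diff R 1 isT; rewrite ln1 subr0.
have L2 : ln 2 <= ln n%:R :> R by rewrite ler_ln ?posrE // ler_nat.
have kL : k%:R <= 1 + 2 * ln n%:R :> R.
  have : (k.-1)%:R * ln 2 <= ln n%:R :> R.
    by rewrite mulr_natl -lnXn // ler_ln ?posrE ?exprn_gt0 // -natrX ler_nat ltnW.
  have : 0 <= (k.-1)%:R * (ln 2 - 2^-1) :> R by rewrite mulr_ge0 // subr_ge0.
  case: k {nk kn} => [|k] /=; first by move: (ln n%:R) L2 ln2 => L; lra.
  by rewrite -[k.+1%:R]natr1; move: (ln n%:R) (ln 2) k%:R => L l q; lra.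
have L9 : ln (9 * n%:R) <= 5 * ln n%:R :> R.
  rewrite lnM ?posrE //; have : ln 9 <= 4 * ln 2 :> R; last by lra.
  by rewrite mulr_natl -lnXn // ler_ln ?posrE ?exprn_gt0 // -natrX ler_nat.
have L90 : 0 <= ln (9 * n%:R) :> R.
  by rewrite ln_ge0 // -natrM ler1n muln_gt0 (ltnW n1).
rewrite /powR gt_eqF //; move: (ln (9 * n%:R)) L9 L90 => l9 L9 L90.
rewrite -[leLHS]lnK ?posrE ?mulr_gt0 ?exprn_gt0 ?expR_gt0 // ler_expR.
rewrite !lnM ?posrE ?mulr_gt0 ?exprn_gt0 ?expR_gt0 // expRK !lnXn ?exprn_gt0 //.
rewrite -[ln n%:R *+ k]mulr_natl.
move: (ln n%:R) (ln 2) k%:R L2 ln2 kL L9 => L l q L2 ln2 kL L9.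
have p1 : 0 <= (5 * L - l9) * (2 + L) by apply: mulr_ge0; lra.
have p2 : 0 <= (1 + 2 * L - q) * L by apply: mulr_ge0; lra.
have p3 : 0 <= (L - 2^-1) * L by apply: mulr_ge0; lra.
have p4 : 0 <= L * L by apply: mulr_ge0; lra.
lra.
Qed.

End Containment.

Section ContainingProgression.
Variable R : realType.

(** Each [`|c i 0|] is at most [(n c_i^2 + 1 / n) / 2]. *)
Lemma sum_norm_le1 n (c : 'cV[R]_n) : (0 < n)%N ->
  sqn c <= n%:R^-1 -> \sum_i `|c i 0| <= 1.
Proof.
move=> n0 cn; have n0' : 0 < n%:R :> R by rewrite ltr0n.
apply: (@le_trans _ _ (\sum_i (n%:R * c i 0 ^+ 2 + n%:R^-1) / 2)).
  apply: ler_sum => i _; rewrite -[c i 0 ^+ 2]real_normK ?num_real //.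
  have : 0 <= n%:R * (`|c i 0| - n%:R^-1) ^+ 2.
    by rewrite mulr_ge0 ?sqr_ge0 // ltW.
  have -> : n%:R * (`|c i 0| - n%:R^-1) ^+ 2 =
      n%:R * `|c i 0| ^+ 2 + n%:R^-1 - 2 * `|c i 0| by field; rewrite gt_eqF.
  move: `|_| (n%:R^-1) => z y; lra.
rewrite -mulr_suml big_split /= -mulr_sumr sumr_const card_ord.
rewrite -[n%:R^-1 *+ n]mulr_natl.
rewrite divff ?gt_eqF // -/(sqn c).
have : n%:R * sqn c <= 1 by rewrite -ler_pdivlMl // mulr1.
by lra.
Qed.

Lemma upper_unitri_bound n (N : 'M[R]_n) (x : 'cV[R]_n) (s a : R) (l : 'I_n) :
  upper_unitri N -> 0 <= s -> 0 <= a -> (forall i j, `|N i j| <= s) ->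
  (forall j : 'I_n, (l <= j)%N -> `|x j 0| <= a) ->
  `|(N *m x) l 0| <= n%:R * (s * a).
Proof.
move=> Ntri s0 a0 Ns xa; rewrite mxE (le_trans (ler_norm_sum _ _ _)) //.
apply: (@le_trans _ _ (\sum_(j < n) s * a)).
  apply: ler_sum => j _; rewrite normrM; have [lj|jl] := leqP l j.
    by rewrite ler_pM ?xa.
  by rewrite Ntri ?(ltnW jl) // -val_eqE /= gtn_eqF // normr0 mul0r mulr_ge0.
by rewrite sumr_const card_ord mulr_natl.
Qed.

(** In the basis [A] the form becomes [\sum_l (r_l (N2 z)_l)^2] with [r_l] at most
    [h r_j] for [l <= j], and [N2], [N2^-1] have entries at most [s]. A vector with
    [|z_j| <= beta / r_j] then has all [|r_l (N2 z)_l| <= 1 / n]; conversely a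
    lattice point of [K] has [|r_l (N2 z)_l| <= 2 n], hence
    [|z_j| <= 2 n^2 s h / r_j]. *)
Lemma containing_progression n (K : set 'cV[R]_n) :
  (1 < n)%N -> symmetric_convex_body K ->
  exists (A : 'M[int]_n) (b : 'cV[R]_n),
  [/\ \det A != 0, GAP A b `<=` K &
    K `&` int_lattice R n `<=` GAP A ((n%:R `^ (50 * ln n%:R)) *: b)].
Proof.
move=> n1 Kb; have n0 := ltnW n1.
have n0' : 0 < n%:R :> R by rewrite ltr0n.
have [X [Xu KX Xcoord]] := near_auerbach Kb.
pose G := invmx X.
have [U1 [N [d [U1u Ntri d0 quad KZ]]]] :=
  korkine_zolotarev (mulmxV Xu : X *m G = 1%:M).
have decay := kz_decay Ntri d0 KZ.
pose k := up_log 2 n.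
have nk : (n <= 2 ^ k)%N by exact: up_logP.
have kn : (2 ^ k.-1 < n)%N by exact: up_log_gtn.
have [U2 [N2' [U2u N2tri N2'tri N2'N2 N2s]]] := seysen nk (leqnn n) n0 Ntri.
set N2 := N *m map_mx intr U2 in N2tri N2'N2 N2s.
pose s : R := n%:R ^+ k.
pose H : R := expR (ln (9 * n%:R) * (2 + ln n%:R)).
pose h := Num.sqrt H.
pose r l := Num.sqrt (d l 0).
have s0 : 0 < s by rewrite exprn_gt0.
have h0 : 0 < h by rewrite sqrtr_gt0 expR_gt0.
have hh : h ^+ 2 = H by rewrite sqr_sqrtr // expR_ge0.
have r0 l : 0 < r l by rewrite sqrtr_gt0.
have rr l : r l ^+ 2 = d l 0 by rewrite sqr_sqrtr // ltW.
have rh (i j : 'I_n) : (i <= j)%N -> r i <= h * r j.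
  move=> ij; rewrite mulrC /r /h -sqrtrM ?(ltW (d0 j)) // ler_wsqrtr //.
  exact: decay.
pose A := U1 *m U2.
have Au : A \in unitmx by rewrite unitmx_mul U1u.
have quadA (z : 'cV[int]_n) : sqn (G *m map_mx intr (A *m z)) =
    \sum_l (r l * (N2 *m map_mx intr z) l 0) ^+ 2.
  rewrite /A -mulmxA map_mxM quad map_mxM mulmxA -/N2.
  by apply: eq_bigr => l _; rewrite exprMn rr.
(* Chosen so that [n * (s * (h * beta)) = 1 / n], which [sum_norm_le1] needs. *)
pose beta := (n%:R ^+ 2 * s * h)^-1.
have beta0 : 0 < beta by rewrite invr_gt0 !mulr_gt0 ?exprn_gt0.
exists A, (\col_j (beta / r j)); split.
- by apply: contraTneq Au => A0; rewrite unitmxE A0.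
- move=> _ [z zb <-].
  set c := G *m map_mx intr (A *m z).
  have -> : map_mx intr (A *m z) = \sum_j c j 0 *: col j X.
    rewrite -[LHS](mulKVmx Xu) -/G -/c; apply/colP => i; rewrite mxE summxE.
    by apply: eq_bigr => j _; rewrite !mxE mulrC.
  apply: (body_sum Kb) => //; apply: sum_norm_le1 => //.
  rewrite /c quadA.
  apply: (@le_trans _ _ (\sum_(l < n) n%:R^-1 ^+ 2)); last first.
    by rewrite sumr_const card_ord -[_ *+ n]mulr_natl expr2 mulVKf ?gt_eqF.
  apply: ler_sum => l _; rewrite -[X in X <= _]real_normK ?num_real //.
  apply: lerXn2r; rewrite ?nnegrE ?invr_ge0 ?ler0n //.
  rewrite normrM gtr0_norm //.
  have := @upper_unitri_bound n N2 (map_mx intr z) s (h * beta / r l) l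
    N2tri (ltW s0).
  have a0 : 0 <= h * beta / r l by rewrite divr_ge0 ?mulr_ge0 // ltW.
  move=> /(_ a0 (fun i j => (N2s i j).1)) bound.
  rewrite -ler_pdivlMl //; apply: le_trans (bound _) _.
    move=> j lj; have := zb j; rewrite !mxE -intr_norm => /le_trans; apply.
    rewrite -mulrA mulrCA ler_pM2l // ler_pdivlMr // mulrC ler_pdivrMr //.
    exact: rh.
  rewrite le_eqVlt; apply/orP; left; apply/eqP; rewrite /beta; field.
  by rewrite !gt_eqF.
- move=> x [Kx [y _ yx]]; have [z yz] : {z | y = A *m z}.
    by exists (invmx A *m y); rewrite mulKVmx.
  exists z; last by rewrite -yz.
  have sq : sqn (G *m map_mx intr (A *m z)) <= (2 * n%:R) ^+ 2.
    apply: (@le_trans _ _ (\sum_(i < n) 2 ^+ 2)).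
      apply: ler_sum => i _; rewrite -[X in X <= _]real_normK ?num_real //.
      apply: lerXn2r; rewrite ?nnegrE //.
      by rewrite -yz yx; exact: Xcoord.
    rewrite sumr_const card_ord -[_ *+ n]mulr_natl exprMn mulrC ler_pM2l //.
    by rewrite -natrX ler_nat; nia.
  have N2z l : `|(N2 *m map_mx intr z) l 0| <= 2 * n%:R / r l.
    rewrite ler_pdivlMr // mulrC -[r l]gtr0_norm // -normrM.
    rewrite -(ler_pXn2r (_ : (0 < 2)%N)) ?nnegrE ?mulr_ge0 ?ler0n //.
    rewrite real_normK ?num_real //; apply: le_trans sq.
    rewrite quadA (bigD1 l) //= lerDl; apply: sumr_ge0 => j _.
    exact: sqr_ge0.
  move=> j; rewrite !mxE.
  have zE : map_mx intr z = N2' *m (N2 *m map_mx intr z).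
    by rewrite mulmxA N2'N2 mul1mx.
  have -> : (`|z j 0|%:~R : R) = `|(map_mx intr z : 'cV[R]_n) j 0|.
    by rewrite mxE intr_norm.
  rewrite zE.
  have a0 : 0 <= 2 * n%:R * h / r j by rewrite divr_ge0 ?mulr_ge0 ?ler0n // ltW.
  apply: le_trans (upper_unitri_bound N2'tri (ltW s0) a0
    (fun i j => (N2s i j).2) _) _.
    move=> l jl; apply: le_trans (N2z l) _.
    rewrite ler_pdivrMr // mulrAC ler_pdivlMr // -[leRHS]mulrA.
    by rewrite ler_pM2l ?mulr_gt0 ?rh.
  have := @containment_factor_bound R n k n1 nk kn; rewrite -/s -/H -hh.
  move=> factor.
  apply: le_trans (_ : 2 * n%:R ^+ 4 * s ^+ 2 * h ^+ 2 * (beta / r j) <= _).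
    rewrite le_eqVlt; apply/orP; left; apply/eqP; rewrite /beta; field.
    by rewrite !gt_eqF.
  by rewrite ler_wpM2r // divr_ge0 // ltW.
Qed.

(** The factor [n^(C ln n)] is 1 in dimension 1, which leaves no room for a
    loss. *)
Lemma containing_progression_dim1 (K : set 'cV[R]_1) :
  symmetric_convex_body K ->
  exists b : 'cV[R]_1, GAP 1%:M b `<=` K /\ K `&` int_lattice R 1 `<=` GAP 1%:M b.
Proof.
move=> Kb.
have Sfin : finite_set [set z : 'cV[int]_1 | K (map_mx intr z)].
  have [r r0 Kr] := body_bounded Kb.
  apply: sub_finite_set (@finite_int_bounded R 1 r) => z /= Kz i.
  by have := Kr _ Kz i; rewrite mxE intr_norm.
have [|z Kz zmax] :=
    @finite_set_argmin R _ _ (fun z : 'cV[int]_1 => - `|z 0 0|%:~R) Sfin.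
  by exists 0; rewrite /= map_mx0; exact: body0.
exists (const_mx `|z 0 0|%:~R); split=> [_ [y yb <-]|x [Kx [y _ yx]]].
  rewrite mul1mx; have := yb 0; rewrite mxE ler_int => yz.
  have [z0|z0] := eqVneq (z 0 0) 0.
    move: yz; rewrite z0 normr0 normr_le0 => /eqP y0.
    rewrite (_ : y = 0) ?map_mx0; first exact: body0.
    by apply/matrixP => i j; rewrite !ord1 mxE.
  pose c : R := (y 0 0)%:~R / (z 0 0)%:~R.
  have -> : map_mx intr y = \sum_(j < 1) c *: (map_mx intr z : 'cV[R]_1).
    apply/matrixP => i j; rewrite big_ord1 !ord1 !mxE divfK // intr_eq0 //.
  apply: (body_sum Kb) => //; rewrite big_ord1 normrM normfV.
  by rewrite -!intr_norm ler_pdivrMr ?mul1r ?ler_int // ltr0z normr_gt0.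
exists y; last by rewrite mul1mx.
move=> i; rewrite mxE ord1 -lerN2; apply: zmax => /=; by rewrite yx.
Qed.

End ContainingProgression.

Theorem theorem1p1 (R : realType) :
  exists2 C : R, 0 < C &
    forall (n : nat) (K : set 'cV[R]_n),
      (1 <= n)%N -> symmetric_convex_body K ->
      (exists (A : 'M[int]_n) (b : 'cV[R]_n),
        [/\ \det A != 0,
            GAP A b `<=` K &
            K `&` int_lattice R n
              `<=` GAP A ((n%:R `^ (C * ln n%:R)) *: b)]) /\
      (exists (A : 'M[int]_n) (b : 'cV[R]_n),
        [/\ \det A != 0,
            GAP A b `<=` K &
            #|` fset_set (K `&` int_lattice R n)|%:R
              < (C * n%:R) ^+ n * #|` fset_set (GAP A b)|%:R]).
Proof.
exists 50 => // n K n1 Kb; split.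
  move: n1; rewrite leq_eqVlt => /predU1P[n1|];
    last by move=> /containing_progression; exact.
  subst n; have [b [bK Kb']] := containing_progression_dim1 Kb.
  exists 1%:M, b; split => //; first by rewrite det1 oner_neq0.
  by rewrite powR1 scale1r.
have [A [b [A0 bK b0 cK]]] := progression_of_comparable_cardinality n1 Kb.
exists A, b; split => //.
apply: (@le_lt_trans _ _ ((4 * n) ^ n * #|` fset_set (GAP A b)|)%:R).
  by rewrite ler_nat.
rewrite natrM natrX natrM ltr_pM2r ?ltr0n //.
by rewrite ltrXn2r ?ltr_pM2r ?ltr0n ?ltr_nat -?lt0n ?mulr_ge0 ?ler0n.
Qed.
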